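(* Let $H$ be a Heyting algebra and $a\in H$. Then there exist a set $D$, a subalgebra $H[\iota]\subseteq H^D$ containing the diagonal copy of $H$ in $H^D$, a Heyting algebra $H\langle\Delta(a)\rangle$ and a surjective homomorphism $\pi:H[\iota]\to H\langle\Delta(a)\rangle$ such that, writing $\pi(h)$ for the image under $\pi$ of the diagonal (constant) element corresponding to $h\in H$: (a) the filter $\mathcal D_{\pi(a)}(H\langle\Delta(a)\rangle)$ is principal; (b) the composite homomorphism $H\hookrightarrow H[\iota]\to H\langle\Delta(a)\rangle$ (diagonal embedding followed by $\pi$) is one-to-one; (c) for every $b\in H$ such that the filter $\mathcal D_b(H)$ is principal, the filter $\mathcal D_{\pi(b)}(H\langle\Delta(a)\rangle)$ is principal as well.
   Context: For an element $a$ of a Heyting algebra $A$, $\mathcal D_a(A)=\{d\in A: a\le d \text{ and } (d\to a)=a\}$ is the set of elements dense over $a$; it is a filter of $A$. A filter is principal if it has a smallest element. $H^D$ denotes the direct power (product of $D$ copies of $H$, with pointwise operations), and the diagonal copy of $H$ consists of the constant families. *)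

(* Defs.v *)
From HB Require Import structures.
From mathcomp Require Import all_boot all_order.
From mathcomp Require Import boolp classical_sets.

Set Implicit Arguments.
Unset Strict Implicit.
Unset Printing Implicit Defensive.

Import Order.TTheory.
Local Open Scope order_scope.

(* Distributivity is not required: it follows from the adjunction. The lattice
   with a single element (\bot = \top) is allowed. *)
HB.mixin Record TBLattice_hasImp (d : Order.disp_t) T of Order.TBLattice d T := {
  imp : T -> T -> T;
  leIimp : forall x y z : T, (x `&` y <= z)%O = (x <= imp y z)%O;
}.

#[short(type="heytingType")]
HB.structure Definition Heyting (d : Order.disp_t) :=
  { T of TBLattice_hasImp d T & Order.TBLattice d T }.

Notation "x `=>` y" := (imp x y) (at level 55, right associativity) : order_scope.

HB.mixin Record isImpMorphism (d : Order.disp_t) (T : heytingType d)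
    (d' : Order.disp_t) (T' : heytingType d') (apply : T -> T') := {
  hmorph_imp : {morph apply : x y / x `=>` y};
}.

(* Order.TBLatticeMorphism only concerns \bot and \top. *)
HB.structure Definition HeytingMorphism (d : Order.disp_t) (T : heytingType d)
    (d' : Order.disp_t) (T' : heytingType d') :=
  { f of isImpMorphism d T d' T' f & @Order.LatticeMorphism d T d' T' f
       & @Order.TBLatticeMorphism d T d' T' f }.

Notation "{ 'hmorphism' T -> T' }" :=
  (@HeytingMorphism.type _ T%type _ T'%type)
  (at level 0, T at level 98, T' at level 99,
   format "{ 'hmorphism'  T  ->  T' }") : type_scope.

Section Power.
Variables (D : Type) (d : Order.disp_t) (H : heytingType d).
Implicit Types f g h : D -> H.

Fact botf_le f : (fun=> \bot) <= f.
Proof. by apply/lefP => x; apply: le0x. Qed.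

Fact lef_top f : f <= (fun=> \top).
Proof. by apply/lefP => x; apply: lex1. Qed.

HB.instance Definition _ := Order.hasBottom.Build _ (D -> H) botf_le.
HB.instance Definition _ := Order.hasTop.Build _ (D -> H) lef_top.

Fact leIimpf f g h : (f `&` g <= h) = (f <= (fun x => g x `=>` h x)).
Proof.
apply/lefP/lefP => le_fgh x; first by rewrite -leIimp; apply: le_fgh.
by rewrite meetfE leIimp; apply: le_fgh.
Qed.

HB.instance Definition _ := TBLattice_hasImp.Build _ (D -> H) leIimpf.

Definition diag (h : H) : D -> H := fun=> h.

End Power.

Arguments diag D {d H} h.

Definition imp_closed (d : Order.disp_t) (T : heytingType d) (S : {pred T}) :=
  {in S &, forall x y, x `=>` y \in S}.

HB.mixin Record isImpClosed (d : Order.disp_t) (T : heytingType d)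
    (S : {pred T}) := {
  opred_imp : imp_closed S;
}.

#[short(type="heytingClosed")]
HB.structure Definition HeytingClosed (d : Order.disp_t) (T : heytingType d) :=
  { S of isImpClosed d T S & @Order.LatticeClosed d T S
       & @Order.TBLatticeClosed d T S }.

Section Subalgebra.
Variables (d : Order.disp_t) (T : heytingType d) (S : heytingClosed T).

Definition subalgebra := {x : T | x \in S}.

HB.instance Definition _ := SubChoice.on subalgebra.
HB.instance Definition _ := [SubChoice_isTBSubLattice of subalgebra by <: with d].

Definition sub_imp (x y : subalgebra) : subalgebra :=
  exist _ (val x `=>` val y) (opred_imp _ _ (valP x) (valP y)).

Fact leIsub_imp (x y z : subalgebra) : (x `&` y <= z) = (x <= sub_imp y z).
Proof. by rewrite -!Order.le_val; exact: leIimp. Qed.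

HB.instance Definition _ := TBLattice_hasImp.Build d subalgebra leIsub_imp.

End Subalgebra.

Definition dense_over (d : Order.disp_t) (A : heytingType d) (a : A) : set A :=
  [set x | a <= x /\ x `=>` a = a]%classic.

Definition lattice_filter (d : Order.disp_t) (A : heytingType d) (F : set A) :=
  [/\ F \top, forall x y, F x -> F y -> F (x `&` y)
    & forall x y, F x -> x <= y -> F y].

Definition principal (d : Order.disp_t) (A : heytingType d) (F : set A) :=
  lattice_filter F /\ exists2 m, F m & lbound F m.

Section DenseOver.
Variables (d : Order.disp_t) (A : heytingType d).
Implicit Types x y z : A.

Lemma impA x y z : x `&` y `=>` z = x `=>` y `=>` z.
Proof.
apply/le_anti/andP; split; first by rewrite -!leIimp -meetA leIimp.
by rewrite -leIimp meetA !leIimp.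
Qed.

Lemma le_imp x y : y <= x `=>` y.
Proof. by rewrite -leIimp leIl. Qed.

Lemma dense_over_filter (a : A) : lattice_filter (dense_over a).
Proof.
split=> [|x y [ax xa] [ay ya]|x y [ax xa] xy].
- split; first exact: lex1.
  by apply/le_anti; rewrite le_imp andbT -[X in X <= _]meetx1 leIimp.
- by split; rewrite ?lexI ?ax ?ay // impA ya xa.
split; first exact: le_trans xy.
apply/le_anti; rewrite le_imp andbT -[X in _ <= X]xa -leIimp.
by apply: le_trans (leI2 (lexx _) xy) _; rewrite leIimp.
Qed.

End DenseOver.

(* Main.v *)
Require Import Defs.
From HB Require Import structures.
From mathcomp Require Import all_boot all_order.
From mathcomp Require Import boolp classical_sets.

Import Order.TTheory.

(** Let [D] be the filter of elements dense over [a], and call [f : D -> H]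
    coherent if [d `&` e] lies below the equivalence of [f d] and [f e]; as the
    Heyting operations respect equivalence modulo an element, coherent functions
    form a subalgebra of the power. It contains the constants and the inclusion
    [iota : D -> H]. Identify two coherent functions when they agree on all
    sufficiently small elements of [D]. Constants stay distinct, and a property
    of values, such as lying in a principal filter of [H], passes to the
    quotient; this gives (b) and (c). For (a), the class of [iota] is dense over
    that of [a]. If the values of [f] are dense over [a] below [e], then [f e]
    belongs to [D], and for [x <= e `&` f e] coherence gives
    [x <= f e `=>` f x], hence [x <= f x]: the class of [iota] is least. *)

Set Implicit Arguments.
Unset Strict Implicit.
Unset Printing Implicit Defensive.

Local Open Scope order_scope.
Local Open Scope quotient_scope.

(** * Implication and comparison modulo an element in a Heyting algebra *)

Section HeytingTheory.
Variables (d : Order.disp_t) (A : heytingType d).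
Implicit Types u x y z : A.

Lemma impI_le x y : (x `=>` y) `&` x <= y.
Proof. by rewrite leIimp. Qed.

Lemma imp_eq1 x y : (x `=>` y == \top) = (x <= y).
Proof. by rewrite -le1x -leIimp meet1x. Qed.

Lemma le_imp2 x x' y y' : x' <= x -> y <= y' -> x `=>` y <= x' `=>` y'.
Proof.
move=> x'x yy'; rewrite -leIimp; apply: le_trans yy'.
exact: le_trans (leI2 (lexx _) x'x) (impI_le _ _).
Qed.

Lemma impIr x y z : x `=>` (y `&` z) = (x `=>` y) `&` (x `=>` z).
Proof.
apply/le_anti; rewrite lexI !le_imp2 ?leIl ?leIr //= -leIimp lexI.
by apply/andP; split; rewrite leIimp ?leIl ?leIr.
Qed.

Lemma impUl x y z : (x `|` y) `=>` z = (x `=>` z) `&` (y `=>` z).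
Proof.
apply/le_anti; rewrite lexI !le_imp2 ?leUl ?leUr //= -leIimp meetC leIimp leUx.
by apply/andP; split; rewrite -leIimp meetC leIimp ?leIl ?leIr.
Qed.

Lemma imp_trans x y z : (x `=>` y) `&` (y `=>` z) <= x `=>` z.
Proof.
rewrite -leIimp meetAC; apply: le_trans (impI_le y z).
by rewrite [X in _ <= X]meetC leI2 ?impI_le.
Qed.

(** The hypotheses compare [x] with [x'] and [y] with [y'] after meeting with [u]. This lemma and
    the next two make coherence stable under the lattice operations and implication. *)
Lemma le_impI u x x' y y' :
  u <= x `=>` x' -> u <= y `=>` y' -> u <= x `&` y `=>` x' `&` y'.
Proof.
move=> ux uy; rewrite impIr lexI (le_trans ux) ?(le_trans uy) //;
by rewrite le_imp2 ?leIl ?leIr.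
Qed.

Lemma le_impU u x x' y y' :
  u <= x `=>` x' -> u <= y `=>` y' -> u <= x `|` y `=>` x' `|` y'.
Proof.
move=> ux uy; rewrite impUl lexI (le_trans ux) ?(le_trans uy) //;
by rewrite le_imp2 ?leUl ?leUr.
Qed.

Lemma le_impimp u x x' y y' :
  u <= x' `=>` x -> u <= y `=>` y' -> u <= (x `=>` y) `=>` (x' `=>` y').
Proof.
move=> ux uy; rewrite -leIimp.
apply: le_trans (imp_trans x' x y').
rewrite lexI (le_trans (leIl _ _) ux) /=; apply: le_trans (imp_trans x y y').
by rewrite meetC leI2.
Qed.

End HeytingTheory.

(** * The quotient of a Heyting algebra by a filter *)

Section FilterQuotient.
Variables (d : Order.disp_t) (A : heytingType d) (F : set A).
Hypothesis filterF : lattice_filter F.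
Implicit Types x y z : A.

(** The order of the quotient by [F], pulled back to [A] as a preorder. The laws of the quotient
    then reduce to universal properties of this preorder. *)
Definition lemod x y := `[< F (x `=>` y) >].

Lemma filterI x y : F (x `&` y) <-> F x /\ F y.
Proof.
have [_ FI Fle] := filterF; split=> [Fxy|[Fx Fy]]; last exact: FI.
by split; apply: Fle Fxy _; rewrite ?leIl ?leIr.
Qed.

Lemma lemod_le x y : x <= y -> lemod x y.
Proof.
have [F1 _ _] := filterF.
by rewrite -imp_eq1 => /eqP xy; apply/asboolP; rewrite xy.
Qed.

Lemma lemod_trans : transitive lemod.
Proof.
have [_ FI Fle] := filterF.
move=> y x z /asboolP Fxy /asboolP Fyz; apply/asboolP.
exact: Fle (FI _ _ Fxy Fyz) (imp_trans x y z).
Qed.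

Lemma lemodI x y z : lemod x (y `&` z) = lemod x y && lemod x z.
Proof.
rewrite /lemod impIr -asbool_and; apply: asbool_equiv_eq; exact: filterI.
Qed.

Lemma lemodU x y z : lemod (x `|` y) z = lemod x z && lemod y z.
Proof.
rewrite /lemod impUl -asbool_and; apply: asbool_equiv_eq; exact: filterI.
Qed.

Lemma lemod_imp x y z : lemod (x `&` y) z = lemod x (y `=>` z).
Proof. by rewrite /lemod impA. Qed.

Definition eqmod x y := lemod x y && lemod y x.

Lemma eqmod_refl : reflexive eqmod.
Proof. by move=> x; rewrite /eqmod !lemod_le. Qed.

Lemma eqmod_sym : symmetric eqmod.
Proof. by move=> x y; rewrite /eqmod andbC. Qed.

Lemma eqmod_trans : transitive eqmod.
Proof.
move=> y x z /andP[xy yx] /andP[yz zy].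
by rewrite /eqmod (lemod_trans xy yz) (lemod_trans zy yx).
Qed.

Canonical eqmod_equiv := EquivRel eqmod eqmod_refl eqmod_sym eqmod_trans.

Definition quotient := {eq_quot eqmod_equiv}.
HB.instance Definition _ := Choice.on quotient.
HB.instance Definition _ := EqQuotient.on quotient.
Implicit Types X Y Z : quotient.

Definition le_quot X Y := lemod (repr X) (repr Y).

Lemma repr_eqmod x : eqmod (repr (\pi_quotient x)) x.
Proof. by apply/eqmodP; rewrite reprK. Qed.

Lemma le_quot_pi x y : le_quot (\pi_quotient x) (\pi_quotient y) = lemod x y.
Proof.
have /andP[rx xr] := repr_eqmod x; have /andP[ry yr] := repr_eqmod y.
apply/idP/idP => [/(lemod_trans xr)/lemod_trans|/(lemod_trans rx)/lemod_trans];
  exact.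
Qed.

Lemma le_quot_refl : reflexive le_quot.
Proof. by move=> X; apply: lemod_le. Qed.

Lemma le_quot_anti : antisymmetric le_quot.
Proof.
by move=> X Y XY; rewrite -[X]reprK -[Y]reprK; apply/eqmodP.
Qed.

Lemma le_quot_trans : transitive le_quot.
Proof. by move=> Y X Z; apply: lemod_trans. Qed.

HB.instance Definition _ :=
  Order.Le_isPOrder.Build d quotient le_quot_refl le_quot_anti le_quot_trans.

Lemma le_pi x y : (\pi_quotient x <= \pi_quotient y) = lemod x y.
Proof. exact: le_quot_pi. Qed.

Definition meetq X Y : quotient := \pi_quotient (repr X `&` repr Y).
Definition joinq X Y : quotient := \pi_quotient (repr X `|` repr Y).
Definition impq X Y : quotient := \pi_quotient (repr X `=>` repr Y).

Lemma lexmeetq X Y Z : (X <= meetq Y Z) = (X <= Y) && (X <= Z).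
Proof. by rewrite -[X]reprK le_pi lemodI -!le_pi !reprK. Qed.

Lemma lejoinqx X Y Z : (joinq X Y <= Z) = (X <= Z) && (Y <= Z).
Proof. by rewrite -[Z]reprK le_pi lemodU -!le_pi !reprK. Qed.

HB.instance Definition _ :=
  Order.POrder_MeetJoin_isLattice.Build d quotient lexmeetq lejoinqx.

Lemma pi_bot_le X : \pi_quotient \bot <= X.
Proof. by rewrite -[X]reprK le_pi lemod_le ?le0x. Qed.

Lemma le_pi_top X : X <= \pi_quotient \top.
Proof. by rewrite -[X]reprK le_pi lemod_le ?lex1. Qed.

HB.instance Definition _ := Order.hasBottom.Build d quotient pi_bot_le.
HB.instance Definition _ := Order.hasTop.Build d quotient le_pi_top.

Lemma leIimpq X Y Z : (X `&` Y <= Z) = (X <= impq Y Z).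
Proof.
by rewrite -[in RHS](reprK X) -[in LHS](reprK Z) !le_pi lemod_imp.
Qed.

HB.instance Definition _ := TBLattice_hasImp.Build d quotient leIimpq.

Definition proj x : quotient := \pi_quotient x.

Lemma le_proj x y : (proj x <= proj y) = lemod x y.
Proof. exact: le_pi. Qed.

Lemma proj_surj X : exists x, proj x = X.
Proof. by exists (repr X); apply: reprK. Qed.

Lemma proj_le : {homo proj : x y / x <= y}.
Proof. by move=> x y xy; rewrite le_proj lemod_le. Qed.

(** Surjectivity of [proj] lets one test an inequality on images only; meets and implications are
    determined by the elements below them, so this suffices to show that [proj] preserves both. *)
Lemma le_projP X Y : (forall z, proj z <= X -> proj z <= Y) -> X <= Y.
Proof. by have [x <-] := proj_surj X => ->. Qed.

Lemma proj_meet : {morph proj : x y / x `&` y}.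
Proof.
by move=> x y; apply/le_anti/andP; split; apply: le_projP => z;
  rewrite lexI !le_proj lemodI.
Qed.

Lemma proj_join : {morph proj : x y / x `|` y}.
Proof.
move=> x y; apply/le_anti/andP; split; last first.
  by rewrite leUx !proj_le ?leUl ?leUr.
(* A join is determined by its upper bounds, so a representative of the join is used as the
   right-hand side of [lemodU]. *)
have [z zE] := proj_surj (proj x `|` proj y).
by rewrite -zE le_proj lemodU -!le_proj zE leUl leUr.
Qed.

Lemma proj_imp : {morph proj : x y / x `=>` y}.
Proof.
by move=> x y; apply/le_anti/andP; split; apply: le_projP => z;
  rewrite -leIimp -proj_meet !le_proj lemod_imp.
Qed.

HB.instance Definition _ := Order.isOrderMorphism.Build _ _ _ _ proj proj_le.
HB.instance Definition _ :=
  Order.isLatticeMorphism.Build _ _ _ _ proj proj_meet proj_join.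
HB.instance Definition _ :=
  Order.isBLatticeMorphism.Build _ _ _ _ proj (erefl : proj \bot = \bot).
HB.instance Definition _ :=
  Order.isTLatticeMorphism.Build _ _ _ _ proj (erefl : proj \top = \top).
HB.instance Definition _ := isImpMorphism.Build _ _ _ _ proj proj_imp.

End FilterQuotient.

(** * Coherent functions and their germs at small elements of the filter *)

Section CoherentFunctions.
Variables (d : Order.disp_t) (H : heytingType d) (E : set H).
Local Notation D := {x : H | E x}.
Implicit Types (u v w : D) (f g : D -> H).

Definition coherent : {pred D -> H} :=
  fun f => `[< forall u v, sval u `&` sval v <= f u `=>` f v >].

Lemma coherentP f :
  reflect (forall u v, sval u `&` sval v <= f u `=>` f v) (f \in coherent).
Proof. exact: asboolP. Qed.

Lemma diag_coherent h : diag D h \in coherent.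
Proof.
apply/coherentP => u v; have /eqP -> : h `=>` h == \top by rewrite imp_eq1.
exact: lex1.
Qed.

Lemma coherentI : {in coherent &, forall f g, f `&` g \in coherent}.
Proof.
move=> f g /coherentP cf /coherentP cg; apply/coherentP => u v.
by rewrite !meetfE le_impI.
Qed.

Lemma coherentU : {in coherent &, forall f g, f `|` g \in coherent}.
Proof.
move=> f g /coherentP cf /coherentP cg; apply/coherentP => u v.
by rewrite !joinfE le_impU.
Qed.

Lemma coherent_imp : imp_closed coherent.
Proof.
move=> f g /coherentP cf /coherentP cg; apply/coherentP => u v.
(* Implication is contravariant on the left, so coherence of [f] is needed with [u] and [v]
   exchanged. *)
by rewrite le_impimp // meetC.
Qed.

HB.instance Definition _ := Order.isTBLatticeClosed.Build _ _ coherent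
  coherentI coherentU (diag_coherent \bot) (diag_coherent \top).
HB.instance Definition _ := isImpClosed.Build _ _ coherent coherent_imp.

Lemma sval_coherent : (sval : D -> H) \in coherent.
Proof.
by apply/coherentP => u v; rewrite -leIimp -meetA leIx2 // leIl orbT.
Qed.

Local Notation S := (subalgebra coherent).
Implicit Types p q : S.

Definition coherent_sval : S := exist _ sval sval_coherent.

(* The congruence induced by [evtop] is agreement on all small enough [u]. *)
Definition evtop : set S :=
  fun p => exists w, forall u, sval u <= sval w -> val p u = \top.

Hypothesis filterE : lattice_filter E.

Lemma evtop_filter : lattice_filter evtop.
Proof.
have [E1 EI _] := filterE; split.
- by exists (exist _ _ E1).
- move=> p q [[v Ev] pv] [[w Ew] qw].
  exists (exist _ _ (EI _ _ Ev Ew)) => u /=; rewrite lexI => /andP[uv uw].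
  by rewrite meetfE pv // qw // meetxx.
- move=> p q [w pw] pq; exists w => u uw; apply/eqP; rewrite -le1x -(pw u uw).
  by move: pq; rewrite -Order.le_val => /lefP.
Qed.

Lemma lemod_evtop p q :
  lemod evtop p q <->
  exists w, forall u, sval u <= sval w -> val p u <= val q u.
Proof.
split=> [/asboolP|] [w pq]; last apply/asboolP; exists w => u uw.
  by rewrite -imp_eq1; apply/eqP; apply: pq.
by apply/eqP; rewrite imp_eq1 pq.
Qed.

Definition germ := @proj _ S evtop evtop_filter.
Definition coherent_diag (h : H) : S := exist _ (diag D h) (diag_coherent h).
Definition const_germ (h : H) := germ (coherent_diag h).

Lemma le_germ p q :
  germ p <= germ q <->
  exists w, forall u, sval u <= sval w -> val p u <= val q u.
Proof. by rewrite le_proj; apply: lemod_evtop. Qed.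

(** A threshold [w] lies below itself, so the values can be compared at [w], where they are the
    constants. *)
Lemma const_germ_inj : injective const_germ.
Proof.
have le h k : const_germ h <= const_germ k -> h <= k.
  by case/le_germ=> w /(_ w (lexx _)).
by move=> h k hk; apply/le_anti; rewrite !le // hk.
Qed.

(** Density consists of two inequalities between germs, each valid below its own threshold; below
    the meet of the thresholds both hold pointwise. *)
Lemma dense_germ p h : dense_over (const_germ h) (germ p) <->
  exists w, forall u, sval u <= sval w -> dense_over h (val p u).
Proof.
have [_ EI _] := filterE.
have imp_germ : germ p `=>` const_germ h = germ (p `=>` coherent_diag h).
  by rewrite /germ proj_imp.
split=> [[/le_germ[[v Ev] hp]]|[w pw]].
  move=> ph; have: germ p `=>` const_germ h <= const_germ h by rewrite ph.
  rewrite imp_germ => /le_germ[[w Ew] {}ph].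
  exists (exist _ _ (EI _ _ Ev Ew)) => u /=; rewrite lexI => /andP[uv uw].
  by split; [exact: hp | apply/le_anti; rewrite le_imp andbT; exact: ph].
split; first by apply/le_germ; exists w => u /pw[].
apply/le_anti; rewrite le_imp andbT imp_germ; apply/le_germ.
by exists w => u /pw[_ ph]; rewrite [X in X <= _]ph.
Qed.

Lemma principal_const_germ h : principal (dense_over h) ->
  principal (dense_over (const_germ h)).
Proof.
move=> [_ [m hm mP]]; split; first exact: dense_over_filter.
exists (const_germ m).
  by apply/dense_germ; have [E1 _ _] := filterE; exists (exist _ _ E1).
(* Below [w] the values of [p] are dense over [h], hence above the least such element [m]. *)
move=> X; have [p <-] := proj_surj X => /dense_germ[w pw].
by apply/le_germ; exists w => u /pw /mP.
Qed.

End CoherentFunctions.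

(** * The germ of the inclusion is the least element dense over the germ of [a] *)

Section DenseGerm.
Variables (d : Order.disp_t) (H : heytingType d) (a : H).
Let filterD := dense_over_filter a.

Lemma principal_const_germ_dense :
  principal (dense_over (const_germ filterD a)).
Proof.
have [D1 DI _] := filterD; split; first exact: dense_over_filter.
exists (germ filterD (coherent_sval (dense_over a))).
  by apply/dense_germ; exists (exist _ _ D1) => u _; exact: svalP.
move=> X; have [p <-] := proj_surj X => /dense_germ[w pw].
(* Evaluating at [w] puts [val p w] in the filter, so its meet with [w] can serve as a threshold. *)
have Dpw := pw w (lexx _).
apply/le_germ; exists (exist _ _ (DI _ _ (svalP w) Dpw)) => u /=.
rewrite lexI => /andP[uw upw].
have /coherentP/(_ w u) := valP p.
by rewrite (meet_idPr uw) -leIimp (meet_idPl upw).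
Qed.

End DenseGerm.

Theorem theorem3p1 (d : Order.disp_t) (H : heytingType d) (a : H) :
  exists (D : Type) (S : heytingClosed (D -> H))
    (diagS : forall h : H, diag D h \in S)
    (d' : Order.disp_t) (K : heytingType d')
    (pi : {hmorphism subalgebra S -> K}),
    let pi_diag (h : H) : K := pi (exist _ (diag D h) (diagS h)) in
    [/\ forall y : K, exists x : subalgebra S, pi x = y,
        principal (dense_over (pi_diag a)),
        injective pi_diag
      & forall b : H, principal (dense_over b) ->
          principal (dense_over (pi_diag b))].
Proof.
pose filterD := dense_over_filter a.
exists {x | dense_over a x}.
exists (HeytingClosed.clone _ _ (@coherent _ H (dense_over a)) _).
exists (@diag_coherent _ _ _).
exists _, _, (proj (evtop_filter filterD)); split.
- exact: proj_surj.
(* Here [pi_diag] is [const_germ filterD] up to conversion. *)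
- exact: principal_const_germ_dense.
- exact: (@const_germ_inj _ _ _ filterD).
- exact: (@principal_const_germ _ _ _ filterD).
Qed.
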